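(* Let $(g_j)_{0\le j\le J}$ be a family of signals in $(\mathbb{R}^+)^N$. For each $j\in\{0,\dots,J\}$, let $Q_j\in\mathbb{C}^N$ be the signal whose discrete Fourier transform is given by $$\hat Q_j[k]=r_j^k\,\widehat{g_j^2}[k],\qquad \forall k=\left\lfloor\tfrac N2\right\rfloor-N+1,\dots,\left\lfloor\tfrac N2\right\rfloor .$$ Then the following two problems are equivalent: 1. Find $f\in\mathbb{C}^N$ with $\hat f[k]=0$ for all $N/2<k\le N-1$ such that $|f\star\psi_j|=g_j$ for all $j\in\{0,\dots,J\}$. 2. Find $f\in\mathbb{C}^N$ with $\hat f[k]=0$ for all $N/2<k\le N-1$ such that $(f\star\psi_j^{low})\,\overline{(f\star\psi_j^{high})}=Q_j$ for all $j\in\{0,\dots,J\}$.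
   Context: Signals are elements $f=(f[0],\dots,f[N-1])$ of $\mathbb{C}^N$, where $N\ge 1$ is a fixed integer. $\mathbb{R}^+$ denotes the nonnegative reals. The discrete Fourier transform is $\hat f[k]=\sum_{n=0}^{N-1}f[n]e^{-2\pi i kn/N}$ for $k=0,\dots,N-1$, and is extended $N$-periodically to $k\in\mathbb{Z}$ (so negative frequency indices are read modulo $N$). The circular convolution is $f\star g[k]=\sum_{n=0}^{N-1}f[n]g[k-n]$, with indices read modulo $N$. Products, squares, moduli and complex conjugates of signals are taken entrywise. Let $J\geq 0$ be an integer, $a\in\,]1,+\infty[$ a dilation factor, and $\psi:\mathbb{R}\to\mathbb{C}$ a fixed mother wavelet with Fourier transform $\hat\psi$. For $0\le j\le J$, the wavelet $\psi_j\in\mathbb{C}^N$ is defined by $\hat\psi_j[k]=\hat\psi(a^jk)$ for $k=0,\dots,N-1$. Fix $r\in\,]0,1[$ and set $r_j=r^{a^j}$. The signals $\psi_j^{low},\psi_j^{high}\in\mathbb{C}^N$ are defined by $\hat\psi_j^{low}[k]=\hat\psi_j[k]\,r_j^k$ and $\hat\psi_j^{high}[k]=\hat\psi_j[k]\,r_j^{-k}$ for $k=0,\dots,N-1$. *)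

(* Defs.v *)
From mathcomp Require Import all_boot all_order all_algebra.
From mathcomp Require Import complex.
From mathcomp Require Import all_classical all_reals all_analysis.

Set Implicit Arguments.
Unset Strict Implicit.
Unset Printing Implicit Defensive.

Import Order.TTheory GRing.Theory Num.Theory.
Import numFieldNormedType.Exports.

Local Open Scope ring_scope.
Local Open Scope complex_scope.

(* e^{i t} *)
Definition cis (R : realType) (t : R) : R[i] := cos t +i* sin t.

Definition signal (R : realType) (N : nat) := 'I_N -> R[i].

(* The value f[k] with the index k read modulo N.  For N > 0 the index
   k mod N lies in {0, ..., N-1}, so the default value 0 is never used. *)
Definition per (R : realType) (N : nat) (f : signal R N) (k : int) : R[i] :=
  oapp f 0 (insub `|(k %% N%:Z)%Z|%N).

(* The defining formula is N-periodic in k, so evaluating it at an arbitrary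
   integer k is the N-periodic extension from {0, ..., N-1}. *)
Definition dft (R : realType) (N : nat) (f : signal R N) (k : int) : R[i] :=
  \sum_(n < N) f n * cis (- (2 * pi * k%:~R * n%:R / N%:R)).

Definition circ_conv (R : realType) (N : nat) (f g : signal R N) : signal R N :=
  fun k => \sum_(n < N) f n * per g (k%:Z - n%:Z).

Definition cintegrable (R : realType) (h : R -> R[i]) : Prop :=
  (@lebesgue_measure R).-integrable setT (fun x => (complex.Re (h x))%:E) /\
  (@lebesgue_measure R).-integrable setT (fun x => (complex.Im (h x))%:E).

Definition cintegral (R : realType) (h : R -> R[i]) : R[i] :=
  (\int[@lebesgue_measure R]_x complex.Re (h x)) +i*
  (\int[@lebesgue_measure R]_x complex.Im (h x)).

(* Normalization: \hat psi(w) = \int psi(x) e^{-iwx} dx. *)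
Definition fourier (R : realType) (psi : R -> R[i]) (w : R) : R[i] :=
  cintegral (fun x => psi x * cis (- (w * x))).

(* A wavelet is an integrable function with vanishing mean. *)
Definition mother_wavelet (R : realType) (psi : R -> R[i]) : Prop :=
  cintegrable psi /\ cintegral psi = 0.

(* The condition N/2 < k is written N < 2k in nat. *)
Definition analytic (R : realType) (N : nat) (f : signal R N) : Prop :=
  forall k : 'I_N, (N < k.*2)%N -> dft f k%:Z = 0.

(* r_j = r^{a^j} *)
Definition scaled_ratio (R : realType) (r a : R) (j : nat) : R := r `^ (a ^+ j).

(* Main.v *)
Require Import Defs.
From mathcomp Require Import all_boot all_order all_algebra.
From mathcomp Require Import complex.
From mathcomp Require Import all_classical all_reals all_analysis.
From mathcomp Require Import ring lra zify.

Set Implicit Arguments.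
Unset Strict Implicit.
Unset Printing Implicit Defensive.

Import Order.TTheory GRing.Theory Num.Theory.
Import numFieldNormedType.Exports.

Local Open Scope ring_scope.
Local Open Scope complex_scope.


(** Write c_k for the discrete Fourier transform of F = f * psi_j; it vanishes
    for k > N/2 by analyticity and at k = 0 because psi has zero mean.  The
    transform of |F|^2 at m is 1/N times the sum of c_k conj(c_l) over
    k - l = m mod N; for F_low conj(F_high) each term gets the extra factor
    s^(k-l) with s = r_j.  On the support of c one has 1 <= k, l <= N/2, so
    |k - l| < N/2 and the congruence is an equality: the extra factor is s^m
    throughout, as in the definition of Q_j.  Since s <> 0 and the frequencies
    used there cover all residues, F_low conj(F_high) = Q_j iff |F|^2 = g_j^2.
    For even N the zero mean is essential: k - l = -N/2 would wrap to N/2. *)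

(** * Complex exponentials and characters modulo N *)

Lemma cisD (R : realType) (x y : R) : cis (x + y) = cis x * cis y.
Proof.
rewrite /cis cosD sinD; apply/eqP; rewrite eq_complex /=; apply/andP.
by split; apply/eqP; ring.
Qed.

Lemma cis0 (R : realType) : cis (0 : R) = 1.
Proof. by rewrite /cis cos0 sin0. Qed.

Lemma conjc_cis (R : realType) (x : R) : (cis x)^* = cis (- x).
Proof. by rewrite /cis cosN sinN. Qed.

(** Since cos x = 1 - 2 sin(x/2)^2 and x/2 lies in ]0, pi[, where the sine is positive, cos x <
    1. *)
Lemma cis_neq1 (R : realType) (x : R) : 0 < x -> x < 2 * pi -> cis (- x) != 1.
Proof.
move=> x0 x2; apply/negP => /eqP [].
rewrite cosN => c1 _.
have s0 : 0 < sin (x / 2) ^+ 2.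
  by apply: exprn_gt0; apply: sin_gt0_pi; apply/andP; split; lra.
have := cos2Dsin2 (x / 2); have := cos_mulr2n (x / 2).
have -> : (x / 2) *+ 2 = x by rewrite -mulr_natr; field.
rewrite c1; lra.
Qed.

Definition chi (R : realType) (N : nat) (m : int) : R[i] :=
  cis (- (2 * pi * m%:~R / N%:R)).

Section Character.
Variables (R : realType) (N : nat).
Hypothesis N_gt0 : (0 < N)%N.

Local Notation chi := (@chi R N).

Lemma chiD m n : chi (m + n) = chi m * chi n.
Proof. by rewrite /chi -cisD intrD; congr cis; ring. Qed.

Lemma chi0 : chi 0 = 1.
Proof. by rewrite /chi mulr0 mul0r oppr0 cis0. Qed.

(* Inside a ring_scope argument [^*] denotes [Num.conj], elsewhere [conjc];
   the two are only convertible, and the theorem uses the former. *)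
Lemma conjC_chi m : (chi m)^*%R = chi (- m).
Proof.
rewrite -[LHS]/((chi m)^*)%C.
by rewrite /chi conjc_cis intrN; congr cis; ring.
Qed.

Lemma natN_neq0 (F : numDomainType) : N%:R != 0 :> F.
Proof. by rewrite pnatr_eq0 -lt0n. Qed.

Lemma chiN : chi N%:Z = 1.
Proof.
rewrite /chi -mulrA divff ?natN_neq0// mulr1.
by rewrite /cis cosN sinN mulr_natl cos2pi sin2pi oppr0.
Qed.

Lemma chiMn m n : chi (m * n%:Z) = chi m ^+ n.
Proof.
elim: n => [|n IHn]; first by rewrite mulr0 chi0.
by rewrite intS mulrDr mulr1 chiD IHn exprS.
Qed.

Lemma chi_dvd m : (N %| m)%Z -> chi m = 1.
Proof.
case/dvdzP=> [[n|n]] ->.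
  by rewrite mulrC chiMn chiN expr1n.
(* Negative multiples of N reduce to positive ones by conjugation. *)
by rewrite NegzE mulNr -conjC_chi mulrC chiMn chiN expr1n rmorph1.
Qed.

Lemma chi_mod m : chi (m %% N%:Z)%Z = chi m.
Proof.
rewrite [in RHS](divz_eq m N%:Z) [RHS]chiD.
by rewrite (@chi_dvd ((m %/ N)%Z * N%:Z)) ?mul1r// dvdz_mull.
Qed.

Lemma chi_neq1 m : ~~ (N %| m)%Z -> chi m != 1.
Proof.
move=> Ndvdm; rewrite -chi_mod; set k := (m %% N%:Z)%Z.
have N0 : N%:Z != 0 by rewrite eqz_nat -lt0n.
have k0 : 0 < k.
  rewrite lt_neqAle modz_ge0// andbT eq_sym.
  by apply/negP => /eqP/dvdz_mod0P; apply/negP.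
have kN : k < N%:Z by rewrite ltz_pmod// ltz_nat.
have NR : 0 < N%:R :> R by rewrite ltr0n.
have pi0 := pi_gt0 R.
apply: cis_neq1.
  by rewrite divr_gt0// mulr_gt0 ?ltr0z//; lra.
rewrite ltr_pdivrMr// ltr_pM2l; last by lra.
by rewrite -[N%:R]/(N%:Z%:~R) ltr_int.
Qed.

(** Orthogonality of characters: the geometric sum times [chi m - 1] is [chi m ^+ N - 1 = 0], and
    [chi m] is 1 only for multiples of N. *)
Lemma sum_chi m :
  \sum_(n < N) chi (m * n%:Z) = if (N %| m)%Z then N%:R else 0.
Proof.
under eq_bigr do rewrite chiMn.
case: ifPn => [Nm|Nm].
  under eq_bigr do rewrite chi_dvd// expr1n.
  by rewrite sumr_const card_ord.
apply/eqP; have := subrX1 (chi m) N.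
rewrite -chiMn chi_dvd ?dvdz_mull// subrr => /esym/eqP.
by rewrite mulf_eq0 subr_eq0 (negPf (chi_neq1 Nm)).
Qed.

(** * Fourier inversion, convolution and products *)

Lemma dftE (f : signal R N) k : dft f k = \sum_(n < N) f n * chi (k * n%:Z).
Proof.
apply: eq_bigr => n _; rewrite /chi intrM; congr (_ * cis _).
by rewrite -!mulrA.
Qed.

Lemma dft_mod (f : signal R N) k l : (k = l %[mod N])%Z -> dft f k = dft f l.
Proof.
move=> kl; rewrite !dftE; apply: eq_bigr => n _.
by rewrite !chiMn -(chi_mod k) kl chi_mod.
Qed.

(** Coefficients are indexed by all integers and need not be N-periodic, so that multipliers such as
    s^k are allowed; only the indices 0, ..., N-1 enter. *)
Definition idft (c : int -> R[i]) (m : int) : R[i] :=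
  N%:R^-1 * \sum_(k < N) c k%:Z * chi (- (k%:Z * m)).


(** Puts reading modulo N in the form that [sum_chi] produces. *)
Lemma perE (f : signal R N) m :
  per f m = \sum_(n < N | (N %| n%:Z - m)%Z) f n.
Proof.
have N0 : N%:Z != 0 by rewrite eqz_nat -lt0n.
have m0 := modz_ge0 m N0.
have mN : (`|(m %% N%:Z)%Z| < N)%N.
  by rewrite -ltz_nat gez0_abs// ltz_pmod// ltz_nat.
rewrite /per insubT/= (big_pred1 (Ordinal mN))// => n.
rewrite -eqz_mod_dvd modz_small ?lez_nat ?ltz_nat ?ltn_ord//.
by rewrite -[RHS]/(val n == _) -eqz_nat/= gez0_abs.
Qed.

Lemma dftK (f : signal R N) m : idft (dft f) m = per f m.
Proof.
rewrite /idft.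
under eq_bigr do rewrite dftE mulr_suml.
rewrite exchange_big/= perE mulr_sumr [RHS]big_mkcond/=.
apply: eq_bigr => n _.
have -> : \sum_(i < N) f n * chi (i%:Z * n%:Z) * chi (- (i%:Z * m)) =
    f n * \sum_(i < N) chi ((n%:Z - m) * i%:Z).
  rewrite mulr_sumr; apply: eq_bigr => k _.
  by rewrite -mulrA -chiD; congr (_ * chi _); ring.
rewrite sum_chi; case: ifP => _; last by rewrite !mulr0.
by rewrite mulrC mulfK// natN_neq0.
Qed.

Lemma per_ord (f : signal R N) (n : 'I_N) : per f n%:Z = f n.
Proof.
rewrite /per modz_small ?lez_nat ?ltz_nat ?ltn_ord//.
by rewrite absz_nat valK.
Qed.

Lemma dft_inj (f g : signal R N) :
  (forall k : 'I_N, dft f k%:Z = dft g k%:Z) -> f =1 g.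
Proof.
move=> fg n; rewrite -!per_ord -!dftK /idft; congr (_ * _).
by apply: eq_bigr => k _; rewrite fg.
Qed.

(** Expand g by Fourier inversion and swap the sums: the character at n - p splits, and the sum over
    p rebuilds the transform of f. *)
Lemma circ_convE (f g : signal R N) (n : 'I_N) :
  circ_conv f g n = idft (fun k => dft f k * dft g k) n%:Z.
Proof.
rewrite /circ_conv; under eq_bigr do rewrite -dftK /idft mulrCA mulr_sumr.
rewrite -mulr_sumr exchange_big/= /idft; congr (_ * _).
apply: eq_bigr => k _; rewrite (dftE f) mulr_suml mulr_suml.
apply: eq_bigr => p _.
have -> : - (k%:Z * (n%:Z - p%:Z)) = k%:Z * p%:Z + - (k%:Z * n%:Z) by ring.
rewrite chiD; ring.
Qed.

Lemma conjC_idft (c : int -> R[i]) m :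
  (idft c m)^*%R = idft (fun k => (c k)^*%R) (- m).
Proof.
rewrite /idft rmorphM fmorphV rmorph_nat rmorph_sum/=; congr (_ * _).
by apply: eq_bigr => k _; rewrite rmorphM/= conjC_chi mulrN opprK.
Qed.

(** Summing over n first, orthogonality keeps the pairs with k - l = m mod N and cancels one of the
    two factors 1/N. *)
Lemma dft_mul_conj (c d : int -> R[i]) m :
  dft (fun n : 'I_N => idft c n%:Z * (idft d n%:Z)^*) m =
  N%:R^-1 * \sum_(k < N) \sum_(l < N | (N %| m - (k%:Z - l%:Z))%Z)
    c k%:Z * (d l%:Z)^*.
Proof.
have E (n : 'I_N) : idft c n%:Z * (idft d n%:Z)^* * chi (m * n%:Z) =
    \sum_(k < N) \sum_(l < N) N%:R^-1 * N%:R^-1 * (c k%:Z * (d l%:Z)^*) *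
      chi ((m - (k%:Z - l%:Z)) * n%:Z).
  rewrite conjC_idft /idft mulrACA.
  rewrite big_distrlr/= mulr_sumr mulr_suml; apply: eq_bigr => k _.
  rewrite mulr_sumr mulr_suml; apply: eq_bigr => l _.
  have -> : (m - (k%:Z - l%:Z)) * n%:Z =
    - (k%:Z * n%:Z) + - (l%:Z * - n%:Z) + m * n%:Z by ring.
  by rewrite !chiD; ring.
rewrite dftE (eq_bigr _ (fun n _ => E n)) exchange_big/= mulr_sumr.
apply: eq_bigr => k _; rewrite exchange_big/= mulr_sumr [RHS]big_mkcond/=.
apply: eq_bigr => l _; rewrite -mulr_sumr sum_chi.
case: ifP => _; last by rewrite mulr0.
by rewrite mulrC !mulrA mulfV ?natN_neq0// mul1r.
Qed.

Lemma dft_low_high (c : int -> R[i]) (s : R) (m : int) :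
  s != 0 -> c 0 = 0 -> (forall k : 'I_N, (N < k.*2)%N -> c k%:Z = 0) ->
  N./2%:Z - N%:Z + 1 <= m -> m <= N./2%:Z ->
  dft (fun n : 'I_N => idft (fun k => c k * (s ^ k)%:C) n%:Z *
                       (idft (fun k => c k * (s ^ (- k))%:C) n%:Z)^*) m =
  (s ^ m)%:C * dft (fun n : 'I_N => idft c n%:Z * (idft c n%:Z)^*) m.
Proof.
move=> s0 c0 cN mlo mhi; rewrite !dft_mul_conj mulrCA; congr (_ * _).
rewrite mulr_sumr; apply: eq_bigr => k _.
rewrite mulr_sumr; apply: eq_bigr => l.
(* Terms with a zero coefficient vanish on both sides, so both indices may be taken in the support
   of c. *)
have [ck|ck0] := eqVneq (c k%:Z) 0; first by rewrite ck !(mul0r, mulr0).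
have [cl|cl0] := eqVneq (c l%:Z) 0;
  first by rewrite cl !(mul0r, rmorph0, mulr0).
have nz (i : 'I_N) : c i%:Z != 0 -> (0 < i)%N && (i.*2 <= N)%N.
  move=> ci; apply/andP; split.
    by rewrite lt0n; apply: contra ci => /eqP ->; apply/eqP.
  by rewrite leqNgt; apply: contra ci => /cN/eqP.
case/andP: (nz _ ck0) (nz _ cl0) => k0 kN /andP[l0 lN] /dvdzP[q mq].
(* As |k - l| <= floor(N/2) - 1, the bounds on m place m - (k - l) between 2 - N and N - 1, so this
   multiple of N is 0. *)
have q0 : q = 0.
  by have := half_leq kN; have := half_leq lN; rewrite !doubleK; nia.
have -> : m = k%:Z - l%:Z by apply/eqP; rewrite -subr_eq0 mq q0 mul0r.
have conjR (x : R) : (x%:C)^*%R = x%:C by exact: conjc_real.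
rewrite [(_ * _)^*%R]rmorphM/= conjR exprzDr ?unitfE//.
by rewrite [(_ * _)%:C]rmorphM/=; ring.
Qed.

End Character.

Theorem mainTheorem2 (R : realType) (N : nat) (hN : (0 < N)%N) (J : nat)
  (a : R) (ha : 1 < a) (r : R) (hr0 : 0 < r) (hr1 : r < 1)
  (psi : R -> R[i]) (hpsi : mother_wavelet psi)
  (psij psilow psihigh : 'I_J.+1 -> signal R N)
  (hpsij : forall (j : 'I_J.+1) (k : 'I_N),
     dft (psij j) k%:Z = fourier psi (a ^+ j * k%:R))
  (hpsilow : forall (j : 'I_J.+1) (k : 'I_N),
     dft (psilow j) k%:Z = dft (psij j) k%:Z * (scaled_ratio r a j ^+ k)%:C)
  (hpsihigh : forall (j : 'I_J.+1) (k : 'I_N),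
     dft (psihigh j) k%:Z = dft (psij j) k%:Z * (scaled_ratio r a j ^- k)%:C)
  (g : 'I_J.+1 -> 'I_N -> R) (hg : forall j n, 0 <= g j n)
  (Q : 'I_J.+1 -> signal R N)
  (hQ : forall (j : 'I_J.+1) (k : int),
     N./2%:Z - N%:Z + 1 <= k -> k <= N./2%:Z ->
     dft (Q j) k =
       (scaled_ratio r a j ^ k)%:C * dft (fun n : 'I_N => ((g j n) ^+ 2)%:C) k) :
  forall f : signal R N,
    (analytic f /\
       forall (j : 'I_J.+1) (n : 'I_N), `|circ_conv f (psij j) n| = (g j n)%:C)
    <->
    (analytic f /\
       forall (j : 'I_J.+1) (n : 'I_N),
         circ_conv f (psilow j) n * (circ_conv f (psihigh j) n)^* = Q j n).
Proof.
have rj0 (j : 'I_J.+1) : scaled_ratio r a j != 0.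
  by rewrite gt_eqF// powR_gt0.
move=> f.
pose s := scaled_ratio r a.
pose c (j : 'I_J.+1) (k : int) := dft f k * dft (psij j) k.
have convE j n : circ_conv f (psij j) n = idft N (c j) n%:Z.
  exact: circ_convE.
have lowE j n : circ_conv f (psilow j) n =
    idft N (fun k => c j k * (s j ^ k)%:C) n%:Z.
  rewrite circ_convE//; congr (_ * _); apply: eq_bigr => k _.
  by rewrite hpsilow mulrA.
have highE j n : circ_conv f (psihigh j) n =
    idft N (fun k => c j k * (s j ^ (- k))%:C) n%:Z.
  rewrite circ_convE//; congr (_ * _); apply: eq_bigr => k _.
  by rewrite hpsihigh mulrA exprnN.
(* At frequency 0 the Fourier integral of psi is its mean. *)
have c0 j : c j 0 = 0.
  have := hpsij j (Ordinal hN); rewrite /c/= mulr0 => ->.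
  rewrite /fourier.
  have -> : (fun x => psi x * cis (- (0 * x))) = psi.
    by apply/funext => x; rewrite mul0r oppr0 cis0 mulr1.
  by rewrite hpsi.2 mulr0.
(* Squaring is reversible here: the modulus and [g j n] are both nonnegative. *)
have normE j n : (`|circ_conv f (psij j) n| = (g j n)%:C) <->
    idft N (c j) n%:Z * (idft N (c j) n%:Z)^* = ((g j n) ^+ 2)%:C.
  rewrite -normCK -convE rmorphXn/=; split=> [->//|/eqP].
  by rewrite eqrXn2 ?normr_ge0 ?lecR ?hg// => /eqP.
have QE j (fan : analytic f) :
    (forall n : 'I_N,
       idft N (c j) n%:Z * (idft N (c j) n%:Z)^* = ((g j n) ^+ 2)%:C) <->
    (forall n : 'I_N,
       circ_conv f (psilow j) n * (circ_conv f (psihigh j) n)^* = Q j n).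
  have cN (k : 'I_N) : (N < k.*2)%N -> c j k%:Z = 0.
    by move=> /fan fk; rewrite /c fk mul0r.
  (* Each residue has a representative in the window where [hQ] applies: k if k <= floor(N/2),
     otherwise k - N. *)
  have win (k : 'I_N) : exists2 m : int, (k%:Z = m %[mod N])%Z &
      (N./2%:Z - N%:Z + 1 <= m) && (m <= N./2%:Z).
    have [kM|Mk] := leqP k N./2.
      by exists k%:Z => //; have := ltn_ord k; lia.
    exists (k%:Z - N%:Z); last by have := ltn_ord k; lia.
    by apply/eqP; rewrite eqz_mod_dvd; apply/dvdzP; exists 1; ring.
  pose F (n : 'I_N) := idft N (c j) n%:Z * (idft N (c j) n%:Z)^*.
  pose LH n := circ_conv f (psilow j) n * (circ_conv f (psihigh j) n)^*.
  have key (m : int) : (N./2%:Z - N%:Z + 1 <= m) && (m <= N./2%:Z) ->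
      dft LH m = (s j ^ m)%:C * dft F m.
    case/andP=> mlo mhi; rewrite -dft_low_high//.
    by congr dft; apply/funext => n; rewrite /LH lowE highE.
  split=> H n.
    apply: (dft_inj hN (f := LH)) => k; have [m km mw] := win k.
    rewrite !(dft_mod hN _ km) key//; case/andP: mw => mlo mhi; rewrite hQ//.
    by congr (_ * dft _ _); apply/funext.
  apply: (dft_inj hN (f := F)
    (g := fun n => ((g j n) ^+ 2)%:C)) => k; have [m km mw] := win k.
  rewrite !(dft_mod hN _ km).
  (* For the converse the factor s^m is cancelled, frequency by frequency. *)
  have sm : (s j ^ m)%:C != 0 by rewrite fmorph_eq0 expfz_neq0.
  apply: (mulfI sm); case/andP: (mw) => mlo mhi; rewrite -hQ// -key//.
  by congr dft; apply/funext.
split=> -[fan H]; split=> // j.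
  by apply/(QE j fan) => n; apply/normE.
by move=> n; apply/normE; move: n; apply/(QE j fan).
Qed.
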